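(* Let $1\le n_1<n_2$ be integers, and set $n_0=0$, $n_3=2n_1+n_2$, $n_4=n_1+2n_2$, $n_5=2n_1+2n_2$, $x=n_1+n_2$, and $$N=4\cdot 10^x+\sum_{i=0}^5 10^{n_i}.$$ If the integers $0$, $n_1$, $2n_1$, $1+n_1+n_2$, $1+2n_1+n_2$, $3n_1+n_2$, $2n_2$, $1+n_1+2n_2$, $2n_1+2n_2$, $1+2n_1+2n_2$, $1+3n_1+2n_2$, $4n_1+2n_2$, $n_1+3n_2$, $1+2n_1+3n_2$, $1+3n_1+3n_2$, $4n_1+3n_2$, $2n_1+4n_2$, $3n_1+4n_2$, and $4n_1+4n_2$ are pairwise different, then $N^2$ contains only the digits $0$, $1$, and $2$ in base $10$. Moreover, this condition of pairwise distinctness is satisfied whenever $n_1\ge 2$ and $n_2\ge 3n_1+1$. *)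

(* Defs.v *)
From mathcomp Require Import all_boot.

Set Implicit Arguments.
Unset Strict Implicit.
Unset Printing Implicit Defensive.

(* Positions are counted from 0 at the units. Positions beyond the leading
   digit give 0, so they are harmless when 0 is an allowed digit. *)
Definition digit10 (m i : nat) : nat := m %/ 10 ^ i %% 10.

Definition only_digits10 (D : seq nat) (m : nat) : Prop :=
  forall i : nat, digit10 m i \in D.

(* [:: n_0; n_1; n_2; n_3; n_4; n_5] *)
Definition exps (n1 n2 : nat) : seq nat :=
  [:: 0; n1; n2; 2 * n1 + n2; n1 + 2 * n2; 2 * n1 + 2 * n2].

Definition bigN (n1 n2 : nat) : nat :=
  4 * 10 ^ (n1 + n2) + \sum_(i < 6) 10 ^ nth 0 (exps n1 n2) i.

Definition critical_exps (n1 n2 : nat) : seq nat :=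
  [:: 0; n1; 2 * n1; 1 + n1 + n2; 1 + 2 * n1 + n2; 3 * n1 + n2; 2 * n2;
      1 + n1 + 2 * n2; 2 * n1 + 2 * n2; 1 + 2 * n1 + 2 * n2;
      1 + 3 * n1 + 2 * n2; 4 * n1 + 2 * n2; n1 + 3 * n2;
      1 + 2 * n1 + 3 * n2; 1 + 3 * n1 + 3 * n2; 4 * n1 + 3 * n2;
      2 * n1 + 4 * n2; 3 * n1 + 4 * n2; 4 * n1 + 4 * n2].

(* Main.v *)
Require Import Defs.
From mathcomp Require Import all_boot.
From mathcomp Require Import zify ring.

(** Put a = 10^n1 and b = 10^n2, so that
    N = 1 + a + b + 4ab + a^2 b + a b^2 + a^2 b^2.  The coefficient 4 is chosen
    so that in N^2 every coefficient which exceeds 2 is 10 or 22: the cross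
    terms 8 = 2 * 4 meet a 2 coming from the other products, and a^2 b^2 gets
    16 + 3 * 2.  Reading 10 as a shift by one place and 22 as 2 * 10 + 2, one
    obtains N^2 as a sum of powers of 10 with coefficients 1 and 2
    ([square_bigN]).  The exponents that occur are the critical ones together
    with n2, which comes from the term 2b.

    When the exponents are distinct these coefficients are the digits of N^2,
    since nothing carries ([digit10_sum_expn]).  The exponent n2 needs no
    separate hypothesis: the only critical exponent it can equal is 2 n1, and
    then 4 n1 + 3 n2 = 2 n1 + 4 n2 are two equal critical exponents.  (This is
    the symmetry e |-> 4 n1 + 4 n2 - e of N^2, a palindrome in a and b up to the
    carries.)

    If n1 >= 2 and n2 >= 3 n1 + 1, the critical exponents are listed in strictly
    increasing order, hence are distinct. *)

Lemma digit10S m i : digit10 m i.+1 = digit10 (m %/ 10) i.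
Proof. by rewrite /digit10 expnS divnMA. Qed.

Lemma digit10_expansion n (d : nat -> nat) i :
  (forall j, d j < 10) -> i < n -> digit10 (\sum_(j < n) d j * 10 ^ j) i = d i.
Proof.
elim: n d i => [|n IHn] d i // dlt10 lt_in.
have -> : \sum_(j < n.+1) d j * 10 ^ j
          = (\sum_(j < n) d j.+1 * 10 ^ j) * 10 + d 0.
  rewrite big_ord_recl muln1 addnC big_distrl /=; congr (_ + _).
  by apply: eq_bigr => j _; rewrite expnSr mulnA.
case: i lt_in => [_ | i lt_in].
  by rewrite /digit10 expn0 divn1 modnMDl modn_small.
rewrite digit10S divnMDl // divn_small // addn0.
exact: (IHn (fun j => d j.+1)).
Qed.

Lemma sum_count_mem (t : seq nat) (F : nat -> nat) n :
  all (ltn^~ n) t -> \sum_(e <- t) F e = \sum_(j < n) count_mem (j : nat) t * F j.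
Proof.
elim: t => [_ | e t IHt /= /andP[lt_en lt_tn]].
  by rewrite big_nil big1.
rewrite big_cons (IHt lt_tn).
under [RHS]eq_bigr do rewrite mulnDl.
rewrite big_split /=; congr (_ + _).
rewrite (bigD1 (Ordinal lt_en)) //= eqxx mul1n big1 ?addn0 // => j.
by rewrite -val_eqE /= eq_sym => /negPf->.
Qed.

(** Grouping equal powers turns the sum into a decimal expansion whose digits
    are the multiplicities; no carry occurs as these are below 10. *)
Lemma digit10_sum_expn (t : seq nat) i :
  (forall j, count_mem j t < 10) ->
  digit10 (\sum_(e <- t) 10 ^ e) i = count_mem i t.
Proof.
move=> cnt_lt10; pose n := maxn i (\max_(e <- t) e).
rewrite (@sum_count_mem t (expn 10) n.+1); last first.
  apply/allP => e te; rewrite /= ltnS leq_max.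
  by rewrite (@leq_bigmax_seq nat t xpredT id) ?orbT.
by rewrite (@digit10_expansion _ (fun j => count_mem j t)) // ltnS leq_maxl.
Qed.

(** Two duplicate-free lists of exponents give digits at most 2: each exponent
    has multiplicity at most 1 in either. *)
Lemma only_digits012_sum_expn (u v : seq nat) :
  uniq u -> uniq v -> only_digits10 [:: 0; 1; 2] (\sum_(e <- u ++ v) 10 ^ e).
Proof.
move=> uniq_u uniq_v i.
have cntE j : count_mem j (u ++ v) = (j \in u) + (j \in v).
  by rewrite count_cat !count_uniq_mem.
rewrite digit10_sum_expn => [|j]; rewrite cntE.
  by case: (_ \in u); case: (_ \in v).
by case: (_ \in u); case: (_ \in v).
Qed.

(** The exponents of the powers of 10 that occur twice in N^2. *)
Definition doubled_exps (n1 n2 : nat) : seq nat :=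
  [:: n2; n1; 3 * n1 + n2; 2 * n1 + 2 * n2; 1 + 2 * n1 + 2 * n2;
      n1 + 3 * n2; 4 * n1 + 3 * n2; 3 * n1 + 4 * n2].

Lemma doubled_exps_subseq n1 n2 :
  subseq (doubled_exps n1 n2) (n2 :: critical_exps n1 n2).
Proof.
(* The bits select, in the order of the list, the exponents with coefficient 2. *)
apply/subseqP.
by exists [:: true; false; true; false; false; false; true; false; false; true;
              true; false; false; true; false; false; true; false; true; false].
Qed.

Lemma square_bigN n1 n2 :
  bigN n1 n2 ^ 2 =
  \sum_(e <- (n2 :: critical_exps n1 n2) ++ doubled_exps n1 n2) 10 ^ e.
Proof.
rewrite /bigN !big_ord_recl big_ord0 !big_cons big_nil /=.
(* A literal multiple such as 3 * n1 unifies with iterated additions, hence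
   [expnD] splits it too. *)
rewrite !expnD !expn0 !expn1.
move: (10 ^ n1) (10 ^ n2) => a b.
ring.
Qed.

Lemma uniq_n2_critical_exps n1 n2 :
  0 < n1 < n2 -> uniq (critical_exps n1 n2) -> uniq (n2 :: critical_exps n1 n2).
Proof.
move=> /andP[n1_gt0 lt_n12] uniq_crit; rewrite cons_uniq uniq_crit andbT.
apply/negP => crit_n2.
have n2E : n2 = 2 * n1.
  by move: crit_n2; rewrite !inE; lia.
(* Positions 15 and 16 hold 4 n1 + 3 n2 and 2 n1 + 4 n2. *)
have := nth_uniq 0 (isT : 15 < size (critical_exps n1 n2))
                 (isT : 16 < size (critical_exps n1 n2)) uniq_crit.
rewrite /=; lia.
Qed.

Lemma uniq_critical_exps n1 n2 :
  2 <= n1 -> 3 * n1 + 1 <= n2 -> uniq (critical_exps n1 n2).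
Proof.
move=> n1_ge2 n2_ge; apply: (sorted_uniq ltn_trans ltnn).
rewrite /=; lia.
Qed.

Theorem lemma18 (n1 n2 : nat) (hn1 : 1 <= n1) (hn12 : n1 < n2) :
  (uniq (critical_exps n1 n2) -> only_digits10 [:: 0; 1; 2] (bigN n1 n2 ^ 2))
  /\ (2 <= n1 -> 3 * n1 + 1 <= n2 -> uniq (critical_exps n1 n2)).
Proof.
split=> [uniq_crit | ]; last exact: uniq_critical_exps.
have uniq_all : uniq (n2 :: critical_exps n1 n2).
  by apply: uniq_n2_critical_exps; rewrite ?hn1.
rewrite square_bigN; apply: only_digits012_sum_expn => //.
exact: subseq_uniq (doubled_exps_subseq n1 n2) uniq_all.
Qed.
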